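(* Let $n\ge2$ and let $\Delta_{n\times n\times n,>0}$ be the set of $n\times n\times n$ probability tensors with all entries strictly positive. Then in $\Delta_{n\times n\times n,>0}$ one has $Mix_n\subset QI_n$, that is, $$Mix_n\cap\Delta_{n\times n\times n,>0}\subset QI_n\cap\Delta_{n\times n\times n,>0}.$$
   Context: $\Delta_{n\times n\times n}$ is the set of real tensors $P=(P_{ijk})_{1\le i,j,k\le n}$ with $P_{ijk}\ge0$ and $\sum_{i,j,k}P_{ijk}=1$. The quasi-independence model $QI_n$ is the set of tensors $P\in\Delta_{n\times n\times n}$ of the form $P_{ijk}=\zeta\gamma_ia_ib_jc_k$ for $i=j=k$ and $P_{ijk}=\zeta a_ib_jc_k$ otherwise, where $\gamma,a,b,c$ are non-negative vectors of length $n$ and $\zeta$ is the normalizing constant. The mixture model $Mix_n$ is the set of tensors $P\in\Delta_{n\times n\times n}$ of the form $P_{ijk}=\alpha a_ib_jc_k+(1-\alpha)d_i$ for $i=j=k$ and $P_{ijk}=\alpha a_ib_jc_k$ otherwise, where $a,b,c,d$ are non-negative vectors of length $n$ each with sum equal to one, and $\alpha\in[0,1]$. *)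

(* Defs.v *)
From mathcomp Require Import all_boot all_order all_algebra.
From mathcomp Require Import classical_sets reals.

Set Implicit Arguments.
Unset Strict Implicit.
Unset Printing Implicit Defensive.

Import Order.TTheory GRing.Theory Num.Theory.

Local Open Scope classical_set_scope.
Local Open Scope ring_scope.

Definition tensor3 (R : realType) (n : nat) : Type := 'I_n -> 'I_n -> 'I_n -> R.

Definition tsum (R : realType) (n : nat) (T : tensor3 R n) : R :=
  \sum_(i < n) \sum_(j < n) \sum_(k < n) T i j k.

Definition simplex3 (R : realType) (n : nat) : set (tensor3 R n) :=
  [set P | (forall i j k, 0 <= P i j k) /\ tsum P = 1].

Definition pos_simplex3 (R : realType) (n : nat) : set (tensor3 R n) :=
  [set P | simplex3 P /\ forall i j k, 0 < P i j k].

Definition nonneg_vec (R : realType) (n : nat) (v : 'I_n -> R) : Prop :=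
  forall i, 0 <= v i.

Definition prob_vec (R : realType) (n : nat) (v : 'I_n -> R) : Prop :=
  nonneg_vec v /\ \sum_(i < n) v i = 1.

Definition qi_weights (R : realType) (n : nat) (g a b c : 'I_n -> R) :
    tensor3 R n :=
  fun i j k =>
    if (i == j) && (j == k) then g i * a i * b j * c k else a i * b j * c k.

(* The normalizing constant zeta is (tsum (qi_weights g a b c))^-1.  If the
   weights sum to 0 this inverse is 0 by convention, and the resulting zero
   tensor is excluded by membership in the simplex. *)
Definition QI (R : realType) (n : nat) : set (tensor3 R n) :=
  [set P | simplex3 P /\
    exists g a b c : 'I_n -> R,
      [/\ nonneg_vec g, nonneg_vec a, nonneg_vec b, nonneg_vec c
        & let zeta := (tsum (qi_weights g a b c))^-1 in
          forall i j k, P i j k = zeta * qi_weights g a b c i j k]].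

Definition Mix (R : realType) (n : nat) : set (tensor3 R n) :=
  [set P | simplex3 P /\
    exists (alpha : R) (a b c d : 'I_n -> R),
      [/\ 0 <= alpha <= 1,
          [/\ prob_vec a, prob_vec b, prob_vec c & prob_vec d]
        & forall i j k,
            P i j k = if (i == j) && (j == k)
                      then alpha * a i * b j * c k + (1 - alpha) * d i
                      else alpha * a i * b j * c k]].

Arguments simplex3 : clear implicits.
Arguments pos_simplex3 : clear implicits.
Arguments QI : clear implicits.
Arguments Mix : clear implicits.

(* Main.v *)
(* Off-diagonal positivity forces alpha and every entry of a, b, c to be
   nonzero, so each diagonal entry can be rescaled to the prescribed value:
   take gamma_i = P_iii / (alpha a_i b_i c_i) and absorb alpha into a.  The
   weights are then P itself, and zeta = 1. *)
Require Import Defs.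
From mathcomp Require Import all_boot all_order all_algebra.
From mathcomp Require Import classical_sets reals.

Import Order.TTheory GRing.Theory Num.Theory.

Local Open Scope classical_set_scope.
Local Open Scope ring_scope.

(** The sole use of [2 <= n]: every [i] then occurs in off-diagonal entries. *)
Lemma ord_neq_exists (n : nat) (i : 'I_n) : (2 <= n)%N -> exists j, i != j.
Proof.
case: n i => [|[|n]] // i _.
by exists (lift i ord0); exact: neq_lift.
Qed.

Lemma tsum_eq (R : realType) (n : nat) (S T : tensor3 R n) :
  (forall i j k, S i j k = T i j k) -> tsum S = tsum T.
Proof. by move=> ST; do 3![apply: eq_bigr => ? _]; exact: ST. Qed.

Theorem proposition6p1 (R : realType) (n : nat) (hn : (2 <= n)%N) :
  Mix R n `&` pos_simplex3 R n `<=` QI R n `&` pos_simplex3 R n.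
Proof.
move=> P [[simP [alpha [a [b [c [d [/andP[alpha0 _] [pa pb pc _] defP]]]]]]] posP].
split=> //; split=> //.
have [[[a0 _] [b0 _]] [c0 _]] := ((pa, pb), pc).
have diag_neq0 i : alpha * a i * b i * c i != 0.
  have [j ij] := ord_neq_exists n i hn.
  (* Both entries are off-diagonal, hence pure products without a [d] term: [P i j i] gives [alpha]
     and [a i] nonzero, [P j i i] gives [b i] and [c i]. *)
  have := lt0r_neq0 (posP.2 i j i); have := lt0r_neq0 (posP.2 j i i).
  rewrite !defP (eq_sym j i) (negPf ij) /= !mulf_eq0 !negb_or.
  by move=> /andP[/andP[_ ->] ->] /andP[/andP[/andP[-> ->]]].
pose g i := P i i i / (alpha * a i * b i * c i).
pose a' i := alpha * a i.
have wP i j k : qi_weights g a' b c i j k = P i j k.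
  rewrite /qi_weights /a'; case: ifP => [/andP[/eqP <- /eqP <-]|ijk].
    (* Regrouping as [g i] times the whole product exposes the denominator of [g i], which cancels
       by [diag_neq0]. *)
    by rewrite -2!(mulrA (g i)) divfK.
  by rewrite defP ijk.
exists g, a', b, c; split=> // [i|i|/= i j k].
- by apply: divr_ge0; [exact: simP.1 | rewrite !mulr_ge0].
- exact: mulr_ge0.
- by rewrite (tsum_eq _ _ _ _ wP) simP.2 invr1 mul1r wP.
Qed.
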